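(* Let $G$ be a chain graph. Then every vertex having maximum degree within its color class of $G$ is a downer vertex for every non-zero eigenvalue of $G$; that is, if $\lambda\neq 0$ is an eigenvalue of $G$ and $v$ is a vertex whose degree is maximum among the vertices of its color class, then $\mathrm{mul}(\lambda,G-v)=\mathrm{mul}(\lambda,G)-1$.
   Context: All graphs are finite, simple and undirected; eigenvalues of a graph are the eigenvalues of its adjacency matrix. A chain graph is a bipartite graph (with fixed color classes) in which the neighborhoods of the vertices in each color class form a chain with respect to inclusion. For a graph $G$ and a real number $\lambda$, $\mathrm{mul}(\lambda,G)$ denotes the multiplicity of $\lambda$ as an eigenvalue of $G$, and $G-v$ is the subgraph induced by $V(G)\setminus\{v\}$. A vertex $v$ is called downer for an eigenvalue $\lambda$ of $G$ if $\mathrm{mul}(\lambda,G-v)=\mathrm{mul}(\lambda,G)-1$. *)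

(* Defs.v *)
From mathcomp Require Import all_boot all_order all_algebra.
From mathcomp Require Import reals.

Set Implicit Arguments.
Unset Strict Implicit.
Unset Printing Implicit Defensive.

Import Order.TTheory GRing.Theory Num.Theory.
Local Open Scope ring_scope.

Record sgraph := SGraph {
  vertex :> finType;
  adj : rel vertex;
  adj_sym : symmetric adj;
  adj_irrefl : irreflexive adj }.

Section Graph.
Variable G : sgraph.

Definition nbhd (v : G) : {set G} := [set u | adj v u].

Definition deg (v : G) : nat := #|nbhd v|.

Section Induced.
Variable S : {set G}.

Definition induced_adj : rel {x : G | x \in S} :=
  [rel x y | adj (val x) (val y)].

Lemma induced_sym : symmetric induced_adj.
Proof. by move=> x y; apply: adj_sym. Qed.

Lemma induced_irrefl : irreflexive induced_adj.
Proof. by move=> x; apply: adj_irrefl. Qed.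

Definition induced : sgraph := SGraph induced_sym induced_irrefl.
End Induced.

Definition del_vertex (v : G) : sgraph := induced [set~ v].

(* The color classes U and W may be empty. *)
Definition bipartition (U W : {set G}) : Prop :=
  [/\ U :|: W = [set: G], [disjoint U & W]
    & forall x y, adj x y ->
        (x \in U) && (y \in W) || (x \in W) && (y \in U)].

Definition nbhd_chain (C : {set G}) : Prop :=
  forall x y, x \in C -> y \in C ->
    (nbhd x \subset nbhd y) || (nbhd y \subset nbhd x).

Definition chain_graph (U W : {set G}) : Prop :=
  [/\ bipartition U W, nbhd_chain U & nbhd_chain W].

Definition max_degree_in (C : {set G}) (v : G) : Prop :=
  v \in C /\ forall u, u \in C -> (deg u <= deg v)%N.
End Graph.

Section Spectrum.
Variable R : realType.

(* Vertices are numbered by the canonical enumeration of the vertex type. *)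
Definition adjmx (G : sgraph) : 'M[R]_#|G| :=
  \matrix_(i, j) (adj (enum_val i) (enum_val j))%:R.

Definition graph_eigenvalue (G : sgraph) (lam : R) : bool :=
  eigenvalue (adjmx G) lam.

(* Dimension of the eigenspace; the adjacency matrix being real symmetric, this
   is also the multiplicity of lam as a root of the characteristic polynomial,
   and the row eigenvectors of eigenspace are the transposed column ones. *)
Definition mul (lam : R) (G : sgraph) : nat :=
  \rank (eigenspace (adjmx G) lam).

(* Computed in int, since subtraction in nat is truncated. *)
Definition downer (G : sgraph) (v : G) (lam : R) : Prop :=
  (mul lam (del_vertex v))%:Z = (mul lam G)%:Z - 1.
End Spectrum.

(* Main.v *)
Require Import Defs.
From mathcomp Require Import all_boot all_order all_algebra.
From mathcomp Require Import reals.

(** If an eigenvector [x] for [lam != 0] vanishes at a vertex [v] of maximum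
    degree in its color class [C], then [x = 0]: going down through the chain of
    neighborhoods in [C], each vertex [w] in [N(v) \ N(u)] only has neighbors
    whose neighborhoods strictly contain [N(u)], so [x w = 0] by induction and
    [lam * x u], being the sum of [x] over [N(u)], equals the sum over [N(v)],
    that is [lam * x v = 0].
    Hence [lam] is a simple eigenvalue of [G]. An eigenvector of [G - v] for
    [lam], extended by [0] at [v], satisfies the eigenvector equations of [G]
    except possibly at [v]; pairing it with an eigenvector of [G], which is
    non-zero at [v], gives the equation at [v] as well, so it is zero. *)

Set Implicit Arguments.
Unset Strict Implicit.
Unset Printing Implicit Defensive.

Import Order.TTheory GRing.Theory Num.Theory.
Local Open Scope ring_scope.

(** The reverse inclusion is possible only as an equality, by comparing cardinalities. *)
Lemma max_degree_nbhd_sub (G : sgraph) (C : {set G}) (v u : G) :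
  nbhd_chain C -> max_degree_in C v -> u \in C -> nbhd u \subset nbhd v.
Proof.
move=> chainC [vC vmax] uC; case/orP: (chainC u v uC vC) => // vu.
have /eqP <- // : nbhd v == nbhd u by rewrite eqEcard vu; exact: vmax.
Qed.

Lemma bipartition_sym (G : sgraph) (U W : {set G}) :
  bipartition U W -> bipartition W U.
Proof.
by case=> UW dUW eUW; split=> [||x y /eUW];
  rewrite 1?setUC 1?disjoint_sym 1?orbC.
Qed.

Section ChainEigenvector.
Variables (R : realType) (G : sgraph) (lam : R).

Definition eigen_eq (x : G -> R) (u : G) : Prop :=
  lam * x u = \sum_(w | adj u w) x w.

Lemma chain_eigenvector_eq0 (C D : {set G}) (v : G) (x : G -> R) :
    bipartition C D -> nbhd_chain C -> max_degree_in C v -> lam != 0 ->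
    (forall u, eigen_eq x u) -> x v = 0 ->
  forall u, x u = 0.
Proof.
move=> [CD dCD eCD] chainC vmax lam0 eigx xv0.
have eq0 u : \sum_(w | adj u w) x w = 0 -> x u = 0.
  by rewrite -eigx => /eqP; rewrite mulf_eq0 (negPf lam0) => /eqP.
have opp u w : u \in D -> adj u w -> w \in C.
  move=> uD /eCD /orP[/andP[uC _]|/andP[_ //]].
  by rewrite (disjointFl dCD uD) in uC.
have oppC u w : u \in C -> adj u w -> w \in D.
  move=> uC /eCD /orP[/andP[_ //]|/andP[uD _]].
  by rewrite (disjointFr dCD uC) in uD.
have xC0 u : u \in C -> x u = 0.
  (* The measure decreases as the degree grows, so the induction hypothesis covers vertices of [C]
     of larger degree. *)
  have [n] := ubnP (#|G| - deg u)%N; elim: n u => // n IHn u ltn uC; apply: (eq0).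
  have sub : nbhd u \subset nbhd v by exact: max_degree_nbhd_sub vmax uC.
  have := eigx v; rewrite /eigen_eq xv0 mulr0 (bigID (adj u)) /= => /esym.
  rewrite [X in _ + X]big1 ?addr0 => [|w /andP[vw nuw]]; last first.
    have [vC _] := vmax; have wD := oppC _ _ vC vw.
    apply: (eq0); apply: big1 => t wt; have tC := opp _ _ wD wt.
    apply: IHn => //; apply: leq_trans (ltn : (_ <= n)%N).
    have ltut : (deg u < deg t)%N.
      apply: proper_card; rewrite properE.
      (* The vertex [w] is a neighbor of [t] but not of [u], so the chain condition makes the
         inclusion of [nbhd u] in [nbhd t] strict. *)
      have ntu : ~~ (nbhd t \subset nbhd u).
        by apply/subsetPn; exists w; rewrite !inE // adj_sym.
      by rewrite ntu; case/orP: (chainC u t uC tC) ntu => // ->.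
    by apply: ltn_sub2l => //; apply: leq_trans ltut (max_card _).
  apply: etrans; apply: eq_bigl => w.
  by have := subsetP sub w; rewrite !inE; case: (adj u w) => [->|];
     rewrite ?andbF.
move=> u; have : u \in C :|: D by rewrite CD inE.
case/setUP=> [/xC0 //|uD]; apply: (eq0); apply: big1 => w uw.
exact/xC0/(opp u).
Qed.

Definition row_fun (r : 'rV[R]_#|G|) (u : G) : R := r 0 (enum_rank u).

Lemma row_fun_eq0 (r : 'rV[R]_#|G|) : (forall u, row_fun r u = 0) -> r = 0.
Proof.
by move=> r0; apply/rowP => i; rewrite mxE -(r0 (enum_val i)) /row_fun enum_valK.
Qed.

Lemma eigenspace_row_funP (r : 'rV[R]_#|G|) :
  reflect (forall u, eigen_eq (row_fun r) u)
          (r <= eigenspace (adjmx R G) lam)%MS.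
Proof.
have sumE u : (r *m adjmx R G) 0 (enum_rank u)
    = \sum_(w | adj u w) row_fun r w.
  rewrite mxE (reindex enum_rank) /=; last exact/onW_bij/enum_rank_bij.
  rewrite [RHS]big_mkcond; apply: eq_bigr => w _.
  by rewrite mxE !enum_rankK adj_sym; case: adj; rewrite ?mulr1 ?mulr0.
apply: (iffP eigenspaceP) => [eigr u | eigr].
  by rewrite /eigen_eq -sumE eigr mxE.
by apply/rowP => i; rewrite -(enum_valK i) sumE -eigr mxE.
Qed.

End ChainEigenvector.

Section Deletion.
Variables (R : realType) (G : sgraph) (lam : R) (v : G).

(** Symmetry of adjacency moves it from [x] to [z], where it acts as [lam]. In the resulting
    equality of sums the terms away from [v] cancel, and [z v] can be divided out of the remaining
    one. *)
Lemma eigen_eq_pairing (x z : G -> R) :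
    (forall u, u != v -> eigen_eq lam x u) -> (forall u, eigen_eq lam z u) ->
    z v != 0 ->
  eigen_eq lam x v.
Proof.
move=> eigx eigz zv0; apply: (mulIf zv0).
have sym : \sum_u (\sum_(w | adj u w) x w) * z u
         = \sum_u (lam * x u) * z u.
  under eq_bigr do rewrite mulr_suml.
  rewrite (exchange_big_dep predT) //=; apply: eq_bigr => w _.
  rewrite mulrAC eigz mulr_suml; apply: eq_big => u; first exact: adj_sym.
  by rewrite mulrC.
move: sym; rewrite (bigD1 v) //= [RHS](bigD1 v) //=.
rewrite [X in _ + X = _](eq_bigr (fun u => lam * x u * z u)) => [/addIr //|u uv].
by rewrite -(eigx u uv).
Qed.

Definition extend0 (y : del_vertex v -> R) (u : G) : R :=
  oapp y 0 (insub u : option (del_vertex v)).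

Lemma extend0_val (y : del_vertex v -> R) (h : del_vertex v) :
  extend0 y (val h) = y h.
Proof. by rewrite /extend0 valK. Qed.

Lemma extend0_deleted (y : del_vertex v -> R) : extend0 y v = 0.
Proof. by rewrite /extend0 insubF // !inE eqxx. Qed.

(** The only neighbor of [val h] that can be lost in the deletion is [v], where the extension
    contributes 0. *)
Lemma eigen_eq_extend0 (y : del_vertex v -> R) (h : del_vertex v) :
  eigen_eq lam y h -> eigen_eq lam (extend0 y) (val h).
Proof.
rewrite /eigen_eq extend0_val => ->.
rewrite [RHS](bigID (mem [set~ v])) /= [X in _ + X]big1 ?addr0; last first.
  by move=> w /andP[_]; rewrite !inE negbK => /eqP ->; apply: extend0_deleted.
rewrite [RHS](eq_bigl (fun w => (w \in [set~ v]) && adj (val h) w)); last first.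
  by move=> w; rewrite andbC.
rewrite [RHS]big_sub_cond; apply: eq_bigr => k _; exact/esym/extend0_val.
Qed.

End Deletion.

Theorem theorem3p3 (R : realType) (G : sgraph) (U W : {set G})
    (chainG : chain_graph U W) (C : {set G}) (CUW : C = U \/ C = W)
    (v : G) (vmax : max_degree_in C v)
    (lam : R) (lam_neq0 : lam != 0) (lam_eig : graph_eigenvalue G lam) :
  downer v lam.
Proof.
have [D bipCD chainC] : exists2 D, bipartition C D & nbhd_chain C.
  case: chainG => bip chU chW.
  by case: CUW => ->; [exists W | exists U => //; apply: bipartition_sym].
have vanish x : (forall u, eigen_eq lam x u) -> x v = 0 -> forall u, x u = 0.
  exact: chain_eigenvector_eq0 bipCD chainC vmax lam_neq0.
have mulG : Defs.mul lam G = 1%N.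
  apply/eqP; rewrite eqn_leq lt0n mxrank_eq0 andbC [X in X && _]lam_eig /=.
  (* Multiplication by [d] reads off the coordinate at [v]: its image has rank at most 1, and by
     [vanish] it is injective on the eigenspace. *)
  pose d : 'cV[R]_#|G| := delta_mx (enum_rank v) 0.
  rewrite /Defs.mul -(mxrank_mul_ker _ d).
  suff -> : (eigenspace (adjmx R G) lam :&: kermx d)%MS = 0.
    by rewrite mxrank0 addn0 rank_leq_col.
  apply/eqP/rowV0P => r; rewrite sub_capmx => /andP[/eigenspace_row_funP eigr].
  move=> /sub_kermxP; rewrite -colE => /matrixP/(_ 0 0); rewrite !mxE => rv0.
  exact/row_fun_eq0/vanish.
have [z eigz zv0] : exists2 z, forall u, eigen_eq lam z u & z v != 0.
  case/eigenvalueP: lam_eig => r /eigenspaceP/eigenspace_row_funP eigr r0.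
  exists (row_fun r) => //; apply: contraNneq r0 => rv0.
  exact/eqP/row_fun_eq0/vanish.
suff mulGv : Defs.mul lam (del_vertex v) = 0%N by rewrite /downer mulG mulGv.
apply/eqP; rewrite mxrank_eq0; apply/rowV0P => r /eigenspace_row_funP eigr.
apply: row_fun_eq0 => h; rewrite -extend0_val; apply: vanish; last first.
  exact: extend0_deleted.
(* Deletion gives the equations away from [v]; the pairing with [z] supplies the one at [v]. *)
have eigx u : u != v -> eigen_eq lam (extend0 (row_fun r)) u.
  move=> uv; have uS : u \in [set~ v] by rewrite !inE.
  exact: (eigen_eq_extend0 (h := Sub u uS)).
move=> u; have [->|] := eqVneq u v; last exact: eigx.
exact: eigen_eq_pairing eigx eigz zv0.
Qed.
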